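(* Let $U$ be a countably infinite set and let $\mathrm{G}$ be an oligomorphic subgroup of the symmetric group $\mathfrak{S}(U)$. Then there exists an order embedding of $(\mathcal{P}(\omega);\subseteq)$, the power set of $\omega$ ordered by inclusion, into $(\overline{\mathrm{G}}[U];\subseteq)$, the set of copies for $\mathrm{G}$ ordered by inclusion.
   Context: $U^U$ carries the function (product) topology, $U$ being discrete. $\overline{\mathrm{G}}$ denotes the closure of $\mathrm{G}$ in $U^U$: the set of maps $f:U\to U$ such that for every finite $F\subseteq U$ there is $g\in\mathrm{G}$ with $f|_F=g|_F$. The set of copies for $\mathrm{G}$ is $\overline{\mathrm{G}}[U]=\{f[U]\mid f\in\overline{\mathrm{G}}\}$. The group $\mathrm{G}$ is oligomorphic if for every $n\geq 1$ the induced action of $\mathrm{G}$ on $U^n$ has only finitely many orbits. *)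

(* Defs.v *)
From mathcomp Require Import all_boot.
From mathcomp Require Import boolp classical_sets functions cardinality.
From mathcomp Require Import filter topology.

Set Implicit Arguments.
Unset Strict Implicit.
Unset Printing Implicit Defensive.

Local Open Scope classical_set_scope.

Definition countably_infinite (U : Type) : Prop :=
  countable [set: U] /\ infinite_set [set: U].

(* Permutations of [U] are represented by their underlying maps; the last
   clause is closure of [G] under inverses. *)
Definition perm_group (U : Type) (G : set (U -> U)) : Prop :=
  [/\ forall g, G g -> bijective g,
      G id,
      forall g h, G g -> G h -> G (g \o h) &
      forall g h, G g -> cancel g h -> cancel h g -> G h].

Definition tuple_orbit (U : Type) (G : set (U -> U)) (n : nat)
  (t : n.-tuple U) : set (n.-tuple U) := [set map_tuple g t | g in G].

Definition oligomorphic (U : Type) (G : set (U -> U)) : Prop :=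
  forall n : nat, 1 <= n -> finite_set (range (@tuple_orbit U G n)).

(* Closure in the product topology on [U -> U], with [U] discrete; agreement
   with the topological [closure] is [fun_closureE] below. *)
Definition fun_closure (U : Type) (G : set (U -> U)) : set (U -> U) :=
  [set f : U -> U | forall F : set U, finite_set F ->
    exists2 g, G g & forall x, F x -> f x = g x].

Definition copies (U : Type) (G : set (U -> U)) : set (set U) :=
  [set range f | f in fun_closure G].

Lemma fun_closureE (U : choiceType) (G : set (U -> U)) :
  fun_closure G = @closure {ptws U -> discrete_topology U} G.
Proof.
apply/seteqP; split=> f.
- move=> Gf B fB.
  pose A (F : set U) := [set g : U -> U | forall x, F x -> f x = g x].
  have FF : Filter (filter_from (@finite_set U) A).
    apply: filter_from_filter; first by exists set0; exact: finite_set0.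
    move=> F1 F2 fin1 fin2; exists (F1 `|` F2); first by rewrite finite_setU.
    by move=> g Ag; split=> x Fx; apply: Ag; [left|right].
  have : filter_from (@finite_set U) A --> (f : {ptws U -> discrete_topology U}).
    apply/cvg_sup => x C [_ [[D Dop <-] Dfx] DC].
    exists [set x] => [|g Ag]; first exact: finite_set1.
    by apply: DC; rewrite /= -(Ag x).
  by move=> /(_ B fB)[F /Gf[g Gg fg] AB]; exists g; split=> //; exact: AB.
- move=> clf F /finite_seqP[s ->].
  have Ff : Filter (nbhs (f : {ptws U -> discrete_topology U})).
    exact: nbhs_filter.
  have [|g [Gg fg]] := clf [set g : U -> U | forall x, x \in s -> f x = g x];
    last by exists g.
  elim: s => [|a s IHs]; first by apply: (@filterS _ _ Ff setT) => //; exact: filterT.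
  have fa : nbhs (f : {ptws U -> discrete_topology U})
              [set g : U -> U | g a = f a].
    exact: (@proj_continuous U (fun=> discrete_topology U) a f
              [set f a] (discrete_set1 _)).
  apply: filterS (filterI fa IHs) => g [/= ga gs] x.
  by rewrite inE => /predU1P[->|/gs].
Qed.

(* Main.v *)
(* Since a set X of points is a copy as soon as it has the one-point extension
   property (back and forth), hulls under Skolem functions choosing a witness in
   each one-point extension orbit are copies. Evaluate all Skolem terms over
   countably many variables at assignments a_0, a_1, ... where a_k is so generic
   that a_k(i) differs from the value of each of the first k terms not containing
   the variable i (i < k). By oligomorphy these evaluations have, modulo G, a
   pointwise limit e, and being a Skolem witness survives in the limit. The
   set A of naturals is sent to the values under e of the terms over A;
   genericity gives e(x_i) outside of it whenever i is not in A. *)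
Require Import Defs.
From HB Require Import structures.
From mathcomp Require Import all_boot.
From mathcomp Require Import boolp classical_sets functions cardinality.

Local Open Scope classical_set_scope.

Lemma seq_dependent_choice (T : Type) (P : seq T -> Prop) :
  P [::] -> (forall s, P s -> exists x, P (rcons s x)) ->
  exists e : nat -> T, forall n, P (mkseq e n).
Proof.
move=> P0 PS; have [x0 _] := PS _ P0.
have /choice[f Pf] : forall s, exists x, P s -> P (rcons s x).
  move=> s; have [/PS[x Px]|nPs] := pselect (P s); first by exists x.
  by exists x0.
pose s_ n := iter n (fun s => rcons s (f s)) [::].
exists (f \o s_) => n; suff -> : mkseq (f \o s_) n = s_ n.
  by elim: n => //= n IHn; exact: Pf.
by elim: n => // n IHn; rewrite mkseqS IHn.
Qed.

Lemma infinite_pigeonhole (S T : Type) (A : set S) (B : set T) (f : S -> T) :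
  infinite_set A -> finite_set B -> (forall x, A x -> B (f x)) ->
  exists y, infinite_set (A `&` f @^-1` [set y]).
Proof.
move=> infA finB fAB; apply: contrapT => /forallNP fin; apply: infA.
apply: (@sub_finite_set _ _ (\bigcup_(y in B) (A `&` f @^-1` [set y]))).
  by move=> x Ax; exists (f x); [exact: fAB|split].
by apply: bigcup_finite => // y _; exact: contrapT (fin y).
Qed.

Lemma fun_inverse (U : Type) (G : set (U -> U)) (g : U -> U) :
  perm_group G -> G g -> exists2 g', G g' & cancel g g' /\ cancel g' g.
Proof.
case=> bijG _ _ invG Gg; have [g' gK g'K] := bijG g Gg.
by exists g' => //; exact: invG gK g'K.
Qed.

(* Each bad set [a (x i) = t i a] meets every line in direction [x i] at most
   once, so that in a grid of side [#|I|.+1] they do not cover everything. *)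
Lemma free_assignment (U : Type) (I : finType) (j : nat -> U) (x : I -> nat)
    (t : I -> (nat -> U) -> U) :
  injective j ->
  (forall i a b, (forall n, n != x i -> a n = b n) -> t i a = t i b) ->
  exists a, forall i, a (x i) <> t i a.
Proof.
move=> injj tx; pose m := \max_i x i; pose N := #|I|.
have xm i : x i < m.+1 by rewrite ltnS /m; exact: (leq_bigmax i).
pose a (f : {ffun 'I_m.+1 -> 'I_N.+1}) n :=
  if n < m.+1 then j (f (inord n)) else j 0.
pose B i := [set f | `[< a f (x i) = t i (a f) >]]%SET.
(* Overwriting coordinate [x i] of a bad [f] loses nothing: the old value there is forced by
   [t i (a f)], which depends on the other coordinates only. *)
have cardB i : #|B i| * N.+1 <= #|{ffun 'I_m.+1 -> 'I_N.+1}|.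
  pose upd (p : {ffun 'I_m.+1 -> 'I_N.+1} * 'I_N.+1) :=
    [ffun k => if k == inord (x i) then p.2 else p.1 k].
  have -> : #|B i| * N.+1 = #|finset.setX (B i) [set: 'I_N.+1]%SET|.
    by rewrite cardsX cardsT card_ord.
  apply: (@leq_card_in _ _ upd) => -[f v] [f' v'].
  rewrite !inE !andbT => /asboolP/= Bf /asboolP/= Bf' /ffunP e.
  have ev : v = v' by have := e (inord (x i)); rewrite !ffunE eqxx.
  have ef k : k != inord (x i) -> f k = f' k.
    by move=> /negPf kx; have := e k; rewrite !ffunE kx.
  have tE : t i (a f) = t i (a f').
    apply: tx => n nx; rewrite /a; case: ifP => // nm; rewrite ef //.
    by apply: contra nx => /eqP/(congr1 val); rewrite /= !inordK // => ->.
  move: Bf Bf'; rewrite -tE => <-; rewrite /a xm => /injj fx.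
  suff -> : f = f' by rewrite ev.
  apply/ffunP => k.
  by have [->|/ef->] := eqVneq k (inord (x i)); first exact/val_inj/esym.
apply: contrapT => /forallNP bad.
have : [set: {ffun 'I_m.+1 -> 'I_N.+1}]%SET \subset (\bigcup_i B i)%SET.
  apply/fintype.subsetP => f _; have /existsNP[i /contrapT fi] := bad (a f).
  by apply/bigcupP; exists i => //; rewrite inE; apply/asboolP.
move=> /subset_leq_card; rewrite cardsT.
have sumB : #|(\bigcup_i B i)%SET| <= \sum_i #|B i|.
  elim/big_ind2: _ => [|A k A' k' Ak Ak'|//]; first by rewrite cards0.
  by rewrite (leq_trans (leq_card_setU _ _).1) // leq_add.
(* A covering would give [N.+1 * M <= N * M], with [M] the positive number of grid points. *)
move=> /leq_trans/(_ sumB); rewrite -(leq_pmul2r (ltn0Sn N)).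
move=> /leq_trans; rewrite big_distrl /= => /(_ _ (leq_sum _ (fun i _ => cardB i))).
rewrite sum_nat_const mulnC leq_pmul2r ?ltnn //.
by apply/card_gt0P; exists [ffun=> ord0].
Qed.

(** Leaves are variables and node labels are codes of Skolem functions; [pickle] enumerates the
    terms. *)
Definition term := GenTree.tree nat.

Fixpoint eval (U : Type) (h : nat -> seq U -> U) (a : nat -> U) (t : term) : U :=
  match t with
  | GenTree.Leaf i => a i
  | GenTree.Node c s => h c (map (eval U h a) s)
  end.

Fixpoint over (A : pred nat) (t : term) : bool :=
  match t with
  | GenTree.Leaf i => A i
  | GenTree.Node _ s => all (over A) s
  end.

Lemma eval_over (U : Type) (h : nat -> seq U -> U) (a b : nat -> U)
    (A : pred nat) (t : term) :
  (forall i, A i -> a i = b i) -> over A t -> eval U h a t = eval U h b t.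
Proof.
move=> ab; elim: t => [i /ab//|c s IHs /= sA]; congr h.
by elim: s IHs sA => //= t s IHs [IHt /IHs{}IHs] /andP[/IHt -> /IHs ->].
Qed.

Lemma over_sub (A B : pred nat) (t : term) :
  (forall i, A i -> B i) -> over A t -> over B t.
Proof.
move=> AB; elim: t => [i /AB//|c s IHs /=].
by elim: s IHs => //= t s IHs [IHt /IHs{}IHs] /andP[/IHt -> /IHs ->].
Qed.

(* [h] serves as a family of Skolem functions for the orbits of [G]: with
   [c = pickle (s, u)], it completes any translate of [s] to one of [(s, u)]. *)
Lemma skolem_functions (U : countType) (G : set (U -> U)) (u0 : U) :
  exists h : nat -> seq U -> U, forall s u g, G g ->
    exists g', [/\ G g', map g' s = map g s & h (pickle (s, u)) (map g s) = g' u].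
Proof.
have /choice[h hP] : forall p : nat * seq U, exists v, forall s u g, G g ->
    p = (pickle (s, u), map g s) ->
    exists g', [/\ G g', map g' s = map g s & v = g' u].
  move=> p; have [|noex] := pselect (exists (s : seq U) (u : U) (g : U -> U),
      G g /\ p = (pickle (s, u), map g s)); last first.
    by exists u0 => s u g Gg pE; case: noex; exists s, u, g.
  (* Any [g] producing this translate will do: equal keys force equal [s], [u] and [map g s]. *)
  case=> s [u [g [Gg pE]]]; exists (g u) => s' u' g' Gg'.
  rewrite pE => -[/(pcan_inj pickleK)[<- <-] <-].
  by exists g.
by exists (fun c t => h (c, t)) => s u g Gg; exact: hP.
Qed.

(** Prefixes of [e] grow so that infinitely many [f k] match them up to [G]: tuples of the next
    length fall into finitely many orbits, and one orbit retains infinitely many [k]. *)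
Lemma limit_modulo (U : Type) (G : set (U -> U)) (T : countType) (t0 : T)
    (f : nat -> T -> U) :
  perm_group G -> oligomorphic G ->
  exists e : T -> U, forall (s : seq T) (K : nat),
    exists k g, [/\ K <= k, G g & forall t, t \in s -> e t = g (f k t)].
Proof.
move=> hG hoG; have [_ idG compG _] := hG.
pose tau n := odflt t0 (unpickle n).
pose S (s : seq U) := [set k | exists2 g, G g &
  map g (mkseq (f k \o tau) (size s)) = s].
have [||e eP] := @seq_dependent_choice U (fun s => infinite_set (S s)).
- suff -> : S [::] = setT by exact: infinite_nat.
  by apply/seteqP; split=> // k _; exists id.
- move=> s infS; pose n := size s.
  pose tk k : n.+1.-tuple U :=
    Tuple (introT eqP (size_mkseq (f k \o tau) n.+1)).
  have [|orb] := @infinite_pigeonhole _ _ _ _ (fun k => @tuple_orbit U G n.+1 (tk k))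
      infS (hoG n.+1 isT); first by move=> k _; exists (tk k).
  move=> inf; have [k0 [[g0 Gg0 g0s] /= orbk0]] := infinite_setN0 inf.
  (* Each remaining [k] has its tuple moved to that of [k0] by some [h] in [G], and then by [g0] to
     the extended prefix. *)
  exists (g0 (f k0 (tau n))); apply: sub_infinite_set inf => k [_ /= orbk].
  have : @tuple_orbit U G n.+1 (tk k) (tk k0).
    rewrite orbk -orbk0; exists id => //.
    by apply/val_inj; rewrite /= map_id.
  case=> h Gh /(congr1 val) hk; exists (g0 \o h); first exact: compG.
  rewrite size_rcons map_comp (hk : map h (mkseq _ _) = mkseq _ _).
  by rewrite mkseqS map_rcons g0s.
exists (e \o pickle) => s K; pose N := (\max_(t <- s) pickle t).+1.
have [k [[g Gg gE] Kk]] : exists k, S (mkseq e N) k /\ K <= k.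
  apply: contrapT => /forallNP nk; apply: (eP N).
  apply: (@sub_finite_set _ _ `I_K) => // k Sk /=.
  by rewrite ltnNge; apply/negP => Kk; apply: (nk k).
exists k, g; split=> // t ts; move: gE; rewrite size_mkseq /mkseq -map_comp.
move=> /eq_in_map/(_ (pickle t)); rewrite mem_iota /= add0n ltnS.
rewrite /tau pickleK /= => -> //.
exact: leq_bigmax_seq.
Qed.

(** Back and forth: even stages give the next point a value in [X], odd stages give the next point,
    if in [X], a preimage. Each finite stage is realized by some [g] in [G], so the limit map lies
    in the closure. *)
Lemma copy_extension (U : countType) (u0 : U) (G : set (U -> U)) (X : set U) :
  perm_group G ->
  (forall s u, (forall x, x \in s -> X x) ->
    exists g, [/\ G g, map g s = s & X (g u)]) ->
  copies G X.
Proof.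
move=> hG ext; have [_ idG compG _] := hG.
pose en n := odflt u0 (unpickle n).
have enK u : en (pickle u) = u by rewrite /en pickleK.
pose covers n (p : U * U) :=
  if odd n then X (en n./2) -> p.2 = en n./2 else p.1 = en n./2.
pose Q g n (p : U * U) := [/\ p.2 = g p.1, X p.2 & covers n p].
have [||e eP] := @seq_dependent_choice (U * U) (fun z =>
    exists2 g, G g & forall n, n < size z -> Q g n (nth (u0, u0) z n)).
- by exists id.
- move=> z [g Gg gz].
  have step p g' : G g' -> (forall n, n < size z -> Q g' n (nth (u0, u0) z n)) ->
      Q g' (size z) p -> exists p, exists2 g, G g &
      forall n, n < size (rcons z p) -> Q g n (nth (u0, u0) (rcons z p) n).
    move=> Gg' g'z g'p; exists p, g' => // n; rewrite size_rcons ltnS nth_rcons.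
    by rewrite leq_eqVlt => /predU1P[->|nz]; rewrite ?ltnn ?eqxx // nz; exact: g'z.
  set v := en (size z)./2.
  have [[oddz Xv]|fwd] := pselect (odd (size z) /\ X v).
    have [g' Gg' [_ g'K]] := fun_inverse U G g hG Gg.
    by apply: (step (g' v, v) g Gg gz); split; rewrite /covers ?oddz //= g'K.
  (* Forward: [g v] is moved into [X] by an element fixing all values so far. Odd stages with [v]
     outside [X] also do this, harmlessly. *)
  have [|g' [Gg' g'z Xg']] := ext (map snd z) (g v).
    move=> _ /mapP[p /(nthP (u0, u0))[n nz <-] ->].
    by have [] := gz n nz.
  apply: (step (v, g' (g v)) (g' \o g)); first exact: compG.
    move=> n nz; have [p2 Xp cov] := gz n nz; split=> //=; rewrite -p2.
    move: g'z; rewrite -[RHS]map_id => /eq_in_map -> //.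
    by apply: map_f; exact: mem_nth.
  split=> //; rewrite /covers /=; case: ifP => // oddz Xv.
  by case: fwd.
have {}eP N : exists2 g, G g & forall n, n < N -> Q g n (e n).
  have [g Gg gN] := eP N; exists g => // n nN.
  by have := gN n; rewrite size_mkseq nth_mkseq //; exact.
have e1 u : (e (pickle u).*2).1 = u.
  have [g _ /(_ _ (ltnSn _))[_ _]] := eP (pickle u).*2.+1.
  by rewrite /covers odd_double doubleK enK.
have e2 v : X v -> (e (pickle v).*2.+1).2 = v.
  have [g _ /(_ _ (ltnSn _))[_ _]] := eP (pickle v).*2.+2.
  by rewrite /covers /= odd_double uphalf_double enK => /[apply].
exists (fun u => (e (pickle u).*2).2).
  move=> F /finite_seqP[s ->].
  have [g Gg gP] := eP (\max_(u <- s) (pickle u).*2).+1.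
  exists g => // u us; have [|-> _ _] := gP (pickle u).*2; last by rewrite e1.
  by rewrite ltnS; exact: leq_bigmax_seq.
apply/seteqP; split=> [_ [u _ <-]|v Xv].
  by have [g _ /(_ _ (ltnSn _))[]] := eP (pickle u).*2.+1.
(* The stage giving [v] the preimage [w] and the stage defining the value at [w] are realized by a
   common [g], so this value is [v]. *)
pose w := (e (pickle v).*2.+1).1; exists w => //.
have [g Gg gP] := eP (maxn (pickle w).*2 (pickle v).*2.+1).+1.
have [|-> _ _] := gP (pickle w).*2; first by rewrite ltnS leq_maxl.
have [|vE _ _] := gP (pickle v).*2.+1; first by rewrite ltnS leq_maxr.
by rewrite e1 -[RHS]e2 // vE.
Qed.

Theorem theorem10p2 (U : Type) (hU : countably_infinite U)
  (G : set (U -> U)) (hG : perm_group G) (hoG : oligomorphic G) :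
  exists phi : set nat -> set U,
    (forall A : set nat, copies G (phi A)) /\
    (forall A B : set nat, A `<=` B <-> phi A `<=` phi B).
Proof.
case: hU => ctU infU.
have [u0 _] := infinite_setN0 infU.
(* Countability lets [U] be replaced by a [countType], which supplies [pickle]. *)
have [U' eU] := @choicePcountable {classic U} ctU.
have {}eU : U = U' := eU; subst U.
have [j injj] : exists j : nat -> U', injective j.
  pose V : pointedType := HB.pack U' (isPointed.Build U' u0).
  have /infiniteP/(@pcard_leP nat V)/unsquash j := infU.
  by exists j => m n; apply: 'inj_j; rewrite inE.
have [h hP] := skolem_functions U' G u0.
pose tau n : term := odflt (GenTree.Leaf 0) (unpickle n).
have /choice[a aP] : forall k, exists a : nat -> U', forall i n, i < k -> n < k ->
    over (predC1 i) (tau n) -> a i <> eval U' h a (tau n).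
  (* One constraint for each pair [(i, n)] below [k] such that the variable [i] does not occur in
     [tau n]. *)
  move=> k; pose I := {p : 'I_k * 'I_k | over (predC1 (p.1 : nat)) (tau p.2)}.
  have [|a aP] := free_assignment U' I j (fun p => (val p).1)
      (fun p a => eval U' h a (tau (val p).2)) injj.
    by move=> q a b ab; apply: eval_over ab (valP q).
  exists a => i n ik nk tn.
  exact: (aP (exist _ (Ordinal ik, Ordinal nk) tn)).
have [e eP] := limit_modulo U' G term (GenTree.Leaf 0)
  (fun k => eval U' h (a k)) hG hoG.
have bijG g : G g -> bijective g by case: hG => + _ _ _; exact.
pose phi (A : set nat) := [set e t | t in [set t | over (fun i => `[< A i >]) t]].
exists phi; split=> [A|A B].
  apply: copy_extension => // s u sA.
  have [ts tsA ->] : exists2 ts, all (over (fun i => `[< A i >])) ts & s = map e ts.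
    elim: s sA => [|x s IHs] sA; first by exists [::].
    have [t tA <-] := sA x (mem_head _ _).
    have [|ts tsA ->] := IHs; first by move=> y ys; apply: sA; rewrite inE ys orbT.
    by exists (t :: ts) => //=; rewrite tsA andbT.
  (* The term [GenTree.Node c ts] names the witness: at a stage [k] matching it and [ts], [h]
     completes the translate of [s] by [g'] with [q u], and [g] brings this back to [s]. *)
  pose c := pickle (map e ts, u).
  have [k [g [_ Gg gE]]] := eP (GenTree.Node c ts :: ts) 0.
  have [g' Gg' [gK g'K]] := fun_inverse U' G g hG Gg.
  have evE : map (eval U' h (a k)) ts = map g' (map e ts).
    rewrite -map_comp; apply/eq_in_map => t tts /=.
    by rewrite gE ?gK // inE tts orbT.
  have [q [Gq qE hE]] := hP (map e ts) u g' Gg'.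
  have [_ _ compG _] := hG; exists (g \o q); split; first exact: compG.
    by rewrite map_comp qE (mapK g'K).
  exists (GenTree.Node c ts); first by [].
  by rewrite gE ?mem_head //= evE hE.
split=> [AB _ [t tA <-]|AB i Ai].
  by exists t => //; apply: over_sub tA => i /asboolP/AB Bi; exact/asboolP.
have [|t tB et] := AB (e (GenTree.Leaf i)).
  by exists (GenTree.Leaf i) => //=; exact/asboolP.
apply: contrapT => nBi.
(* For [k] beyond [i] and [pickle t], [a k] separates the variable [i] from [t]; cancelling the
   injective [g] in [e t = e (GenTree.Leaf i)] contradicts this. *)
have [k [g [kK Gg gE]]] := eP [:: GenTree.Leaf i; t] (maxn i (pickle t)).+1.
apply: (aP k i (pickle t)).
- exact: leq_ltn_trans (leq_maxl _ _) kK.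
- exact: leq_ltn_trans (leq_maxr _ _) kK.
- rewrite /tau pickleK; apply: over_sub tB => n /asboolP Bn /=.
  by apply/eqP => ni; apply: nBi; rewrite -ni.
- rewrite /tau pickleK; apply: (bij_inj (bijG g Gg)).
  have := gE t; rewrite et gE ?mem_head //= => -> //.
  by rewrite !inE eqxx orbT.
Qed.
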